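(* Consider the online selection problem with $C\ge1$ units and valuations in $[L,U]$, $0<L\le U$, $\theta=U/L$. Let $\alpha^*\ge1$ be the solution $\alpha$ of $$\Bigl(1+\frac{\alpha}{C}\Bigr)^{C-\gamma}=\frac{C\theta}{\gamma\alpha},\qquad \gamma=\lceil C/\alpha\rceil ,$$ and, with $\gamma=\lceil C/\alpha^*\rceil$, define the pricing function $$\phi(z)=\begin{cases}L, & z=1,\dots,\gamma,\\ \frac{\gamma L\alpha^*}{C}\bigl(1+\frac{\alpha^*}{C}\bigr)^{z-\gamma-1}, & z=\gamma+1,\dots,C.\end{cases}$$ Then the deterministic dynamic pricing algorithm with pricing function $\phi$ is $\alpha^*$-competitive for the online selection problem. Further, $\alpha^*$ is the minimum competitive ratio that can be attained by deterministic online algorithms.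
   Context: Online selection problem: a seller has $C$ identical units of an item. Buyers $n=1,\dots,N$ arrive one at a time; buyer $n$ has a private valuation $v_n\in[L,U]$. An instance is $I=(v_1,\dots,v_N)$, with $N$ and the valuations unknown in advance. On arrival of buyer $n$ a price $p_n$ is posted; buyer $n$ buys one unit ($x_n=1$) if $v_n\ge p_n$ and fewer than $C$ units have been sold so far, otherwise $x_n=0$. A deterministic online algorithm determines $p_n$ as a function of the past decisions $x_1,\dots,x_{n-1}$ only. The social welfare is $\sum_n v_nx_n$; $\mathrm{ALG}(I)$ denotes that of the algorithm, and $\mathrm{OPT}(I)$ is the sum of the $\min\{C,N\}$ largest valuations. The competitive ratio is $\sup_I\mathrm{OPT}(I)/\mathrm{ALG}(I)$, and an algorithm is $\alpha$-competitive if its competitive ratio is at most $\alpha$. Dynamic pricing algorithm with pricing function $\phi:\{1,\dots,C\}\to[L,U]$: as long as units remain, the price posted to an arriving buyer is $\phi(z)$, where $z-1$ is the number of units sold so far (so $\phi(z)$ is the price of the $z$-th unit sold). *)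

(* Defs.v *)
From HB Require Import structures.
From mathcomp Require Import all_boot all_order all_algebra.
From mathcomp Require Import all_classical all_reals all_analysis.

Set Implicit Arguments.
Unset Strict Implicit.
Unset Printing Implicit Defensive.

Import Order.TTheory GRing.Theory Num.Theory.
Local Open Scope ring_scope.
Local Open Scope classical_set_scope.

(* An instance (v_1, ..., v_N) with N >= 1 is a nonempty sequence. *)
Definition instances (R : realType) (L U : R) : set (seq R) :=
  [set I | (0 < size I)%N /\ {in I, forall v, L <= v <= U}].

(* The price p_n posted to buyer n, given the decisions [:: x_1; ...; x_{n-1}]
   in chronological order. *)
Definition online_algorithm (R : realType) : Type := seq bool -> R.

Fixpoint decisions_after (R : realType) (C : nat) (A : online_algorithm R)
    (past : seq bool) (I : seq R) : seq bool :=
  if I is v :: I' then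
    decisions_after C A
      (rcons past ((A past <= v) && (count id past < C)%N)) I'
  else past.

Definition decisions (R : realType) (C : nat) (A : online_algorithm R)
    (I : seq R) : seq bool :=
  decisions_after C A [::] I.

Definition ALG (R : realType) (C : nat) (A : online_algorithm R)
    (I : seq R) : R :=
  \sum_(n < size I) I`_n * (nth false (decisions C A I) n)%:R.

Definition OPT (R : realType) (C : nat) (I : seq R) : R :=
  \sum_(v <- take C (sort >=%R I)) v.

(* The quotient is taken in the extended reals, where 0^-1 = +oo; hence an
   instance on which the algorithm sells nothing has ratio +oo, since
   OPT > 0 whenever 0 < L. *)
Definition competitive_ratio (R : realType) (C : nat) (L U : R)
    (A : online_algorithm R) : \bar R :=
  ereal_sup [set ((OPT C I)%:E / (ALG C A I)%:E)%E | I in instances L U].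

Definition competitive (R : realType) (C : nat) (L U alpha : R)
    (A : online_algorithm R) : Prop :=
  (competitive_ratio C L U A <= alpha%:E)%E.

(* Units are numbered from 1, so phi is only relevant on 1, ..., C: once C
   units are sold the posted price no longer affects the decisions. *)
Definition dynamic_pricing (R : realType) (phi : nat -> R) :
    online_algorithm R :=
  fun past => phi (count id past).+1.

Definition gamma (R : realType) (C : nat) (alpha : R) : nat :=
  `|Num.ceil (C%:R / alpha)|%N.

(* For 1 <= alpha we have gamma C alpha <= C, so the natural subtraction in
   the exponent is the usual one. *)
Definition is_alpha_star (R : realType) (C : nat) (theta alpha : R) : Prop :=
  1 <= alpha /\
  (1 + alpha / C%:R) ^+ (C - gamma C alpha) =
    C%:R * theta / ((gamma C alpha)%:R * alpha).

Definition pricing_function (R : realType) (C : nat) (L alpha : R)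
    (z : nat) : R :=
  let g := gamma C alpha in
  if (z <= g)%N then L
  else g%:R * L * alpha / C%:R * (1 + alpha / C%:R) ^+ (z - g - 1).

(* Main.v *)
Require Import Defs.
From mathcomp Require Import all_boot all_order all_algebra.
From mathcomp Require Import all_classical all_reals all_analysis.
From mathcomp Require Import ring lra.
Import Order.TTheory GRing.Theory Num.Theory.
Local Open Scope ring_scope.

(* The defining equation of alpha reads [max_k k (alpha / C) (1 + alpha / C)^(C - k)
   = theta], the maximum over [1 <= k <= C] being attained at [k = gamma]; each
   term is increasing in alpha, whence existence and uniqueness. Extend the price
   list by [phi (C + 1) = U]. The prices are then designed so that
   [alpha * \sum_(z <= w) phi z = C * phi (w + 1)] for [gamma <= w <= C].
   Upper bound: if [w] units are sold, every rejected buyer has value at most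
   [p := phi (w + 1)], hence [OPT <= C p + \sum_v max 0 (v - p)], where the last
   sum runs in effect over the buyers served, whose values are at least the prices [phi].
   Lower bound: offer [C] buyers of value [phi gamma = L], then [C] of value
   [phi (gamma + 1)], and so on up to [C] of value [phi (C + 1) = U], and stop
   after the first phase [i] at whose end fewer than [gamma + i] units are sold;
   such a phase exists since only [C] units are available. By minimality the
   [z]-th unit was sold at value at most [phi z], so the same identity bounds the
   ratio from below by alpha. *)

(** * The index [gamma] and the defining equation of alpha *)

Lemma gamma_itv {R : realType} (C : nat) (a : R) : (0 < C)%N -> 0 < a ->
  (gamma C a)%:R - 1 < C%:R / a <= (gamma C a)%:R.
Proof.
move=> C0 a0; have Ca0 : 0 < C%:R / a by rewrite divr_gt0 ?ltr0n.
have -> : (gamma C a)%:R = (Num.ceil (C%:R / a))%:~R :> R.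
  by rewrite /gamma natr_absz ger0_norm // ceil_ge0 (lt_trans _ Ca0) ?ltrN10.
by have := ceil_itv (C%:R / a); rewrite intrB.
Qed.

Lemma gamma_gt0 {R : realType} (C : nat) (a : R) : (0 < C)%N -> 0 < a ->
  (0 < gamma C a)%N.
Proof.
move=> C0 a0; have /andP[_ le_g] := gamma_itv C a C0 a0.
by rewrite -(ltr0n R) (lt_le_trans _ le_g) // divr_gt0 ?ltr0n.
Qed.

Lemma gamma_le {R : realType} (C : nat) (a : R) : (0 < C)%N -> 1 <= a ->
  (gamma C a <= C)%N.
Proof.
move=> C0 a1; have a0 : 0 < a by apply: lt_le_trans a1.
have /andP[lt_g _] := gamma_itv C a C0 a0.
have : C%:R / a <= C%:R :> R by rewrite ler_pdivrMr // ler_peMr.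
by rewrite -ltnS -(ltr_nat R) -natr1; lra.
Qed.

(* [is_alpha_star] reads [rate C (gamma C a) a = theta], and [gamma C a] is the
   index maximizing [rate C k a]. *)
Definition rate {R : realType} (C k : nat) (a : R) : R :=
  k%:R * a / C%:R * (1 + a / C%:R) ^+ (C - k).

Lemma is_alpha_starE {R : realType} (C : nat) (theta a : R) : (0 < C)%N ->
  is_alpha_star C theta a <-> 1 <= a /\ rate C (gamma C a) a = theta.
Proof.
move=> C0; split=> -[a1 e]; split=> //.
all: have a0 : 0 < a by apply: lt_le_trans a1.
all: have g0 : (gamma C a)%:R != 0 :> R by rewrite pnatr_eq0 -lt0n gamma_gt0.
all: have c0 : C%:R != 0 :> R by rewrite pnatr_eq0 -lt0n.
  by rewrite /rate e; field; rewrite g0 c0 gt_eqF.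
by rewrite -e /rate; field; rewrite g0 c0 gt_eqF.
Qed.

Lemma ltr_rate {R : realType} (C k : nat) (a b : R) : (0 < C)%N -> (0 < k)%N ->
  0 < a -> a < b -> rate C k a < rate C k b.
Proof.
move=> C0 k0 a0 ab; have b0 := lt_trans a0 ab.
have c0 : 0 < C%:R :> R by rewrite ltr0n.
have k0' : 0 < k%:R :> R by rewrite ltr0n.
rewrite /rate.
apply: (@lt_le_trans _ _ (k%:R * b / C%:R * (1 + a / C%:R) ^+ (C - k))).
  by rewrite ltr_pM2r ?exprn_gt0 ?addr_gt0 ?divr_gt0 //
    ltr_pM2r ?invr_gt0 // ltr_pM2l.
rewrite ler_wpM2l ?divr_ge0 ?mulr_ge0 ?(ltW b0) //.
by rewrite lerXn2r ?nnegrE ?addr_ge0 ?divr_ge0 ?lerD2l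
  ?ler_pM2r ?invr_gt0 // ltW.
Qed.

(** The last factor gives the increment in [k] the sign of [C / a - k] when [a > 0]. *)
Lemma rateSB {R : realType} (C k : nat) (a : R) : (k < C)%N ->
  rate C k.+1 a - rate C k a =
  a / C%:R * (1 + a / C%:R) ^+ (C - k.+1) * (1 - k%:R * (a / C%:R)).
Proof.
by move=> kC; rewrite /rate -(subnSK kC) exprS -natr1; ring.
Qed.

(** By [rateSB], the rate climbs up to [k = gamma], since [gamma - 1 < C / a], and descends from
    there on, since [C / a <= gamma]. *)
Lemma rate_le_gamma {R : realType} (C k : nat) (a : R) : (0 < C)%N -> 1 <= a ->
  (k <= C)%N -> rate C k a <= rate C (gamma C a) a.
Proof.
move=> C0 a1 kC; have a0 : 0 < a by apply: lt_le_trans a1.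
have c0 : 0 < C%:R :> R by rewrite ltr0n.
have /andP[lt_g le_g] := gamma_itv C a C0 a0.
have fac0 m : 0 <= a / C%:R * (1 + a / C%:R) ^+ m.
  by rewrite mulr_ge0 ?exprn_ge0 ?addr_ge0 ?divr_ge0 // ltW.
have sgn m : (m%:R * (a / C%:R) <= 1) = (m%:R <= C%:R / a).
  by rewrite mulrA ler_pdivrMr // mul1r ler_pdivlMr.
have sgn' m : (1 <= m%:R * (a / C%:R)) = (C%:R / a <= m%:R).
  by rewrite mulrA ler_pdivlMr // mul1r ler_pdivrMr.
have [kg|gk] := leqP k (gamma C a).
  have gC := gamma_le C a C0 a1.
  have step m : (m < gamma C a)%N -> rate C m a <= rate C m.+1 a.
    move=> mg; rewrite -subr_ge0 rateSB ?(leq_trans mg) //.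
    rewrite mulr_ge0 // subr_ge0 sgn (le_trans _ (ltW lt_g)) //.
    by rewrite lerBrDr natr1 ler_nat.
  move: kg; elim: (gamma C a) step => [|g IH] step.
    by rewrite leqn0 => /eqP->.
  rewrite leq_eqVlt ltnS => /predU1P[->//|/IH kg].
  by apply: (le_trans (kg _)) => [m mg|]; apply: step; rewrite ?ltnS // ltnW.
elim: k kC gk => // k IH kC; rewrite ltnS => gk.
apply: (@le_trans _ _ (rate C k a)).
  rewrite -subr_le0 rateSB // mulr_ge0_le0 // subr_le0 sgn'.
  by rewrite (le_trans le_g) // ler_nat.
by move: gk; rewrite leq_eqVlt => /predU1P[->//|]; apply: IH; rewrite ltnW.
Qed.

Lemma rate_ivt {R : realType} (C k : nat) (a b t : R) : a <= b ->
  rate C k a <= t <= rate C k b ->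
  exists2 x, a <= x <= b & rate C k x = t.
Proof.
move=> ab /andP[ta tb].
pose p : {poly R} := (k%:R / C%:R)%:P * 'X *
  (1 + (C%:R^-1)%:P * 'X) ^+ (C - k) - t%:P.
have pE x : p.[x] = rate C k x - t.
  rewrite /p !hornerE /rate; congr (_ * _ ^+ _ - _); first by ring.
  by rewrite [_^-1 * _]mulrC.
have [|x xab /rootP px] := @poly_ivt R p a b ab.
  by rewrite !pE subr_le0 subr_ge0 ta.
exists x => //.
by apply/eqP; rewrite -subr_eq0 -pE px.
Qed.

Lemma alpha_star_exists {R : realType} (C : nat) (theta : R) : (0 < C)%N ->
  1 <= theta -> exists a, is_alpha_star C theta a.
Proof.
move=> C0 t1; have c0 : C%:R != 0 :> R by rewrite pnatr_eq0 -lt0n.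
have rateC (x : R) : rate C C x = x by rewrite /rate subnn expr0 mulr1; field.
(* At [a = 1] the maximizing index is [C], with rate 1. This supplies the lower end for the
   intermediate value argument below. *)
have rate1 k : (k <= C)%N -> rate C k (1 : R) <= theta.
  move=> kC; apply: le_trans t1.
  apply: (le_trans (rate_le_gamma C k 1 C0 (lexx 1) kC)).
  suff -> : gamma C (1 : R) = C by rewrite rateC.
  by rewrite /gamma divr1 -[C%:R]/(C%:Z%:~R) intrKceil.
(* Lower the candidate [theta], which solves [rate C C a = theta], until
   [rate C k a <= theta] for every [k]. *)
have [a [a1 [k /andP[_ kC] ka] le_a]] : exists a, [/\ 1 <= a,
    exists2 k, (0 < k <= C)%N & rate C k a = theta &
    forall k, (0 < k <= C)%N -> rate C k a <= theta].
  (* Equality may hold at any index up to [C]; only the upper bounds are limited to [k <= m].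
     Lowering [a] preserves the bounds already obtained, as rates increase with [a]. *)
  suff: forall m, (m <= C)%N -> exists a, [/\ 1 <= a,
    exists2 k, (0 < k <= C)%N & rate C k a = theta &
    forall k, (0 < k <= m)%N -> rate C k a <= theta] by apply.
  elim=> [_|m IH mC].
    exists theta; split=> // [|k]; last by case: k.
    by exists C; rewrite ?C0 ?leqnn.
  have [a [a1 exk le_a]] := IH (ltnW mC).
  have [le_m|gt_m] := leP (rate C m.+1 a) theta.
    exists a; split=> // k /andP[k0]; rewrite leq_eqVlt => /predU1P[->//|km].
    by apply: le_a; rewrite k0.
  have [|b /andP[b1 ba] bt] := rate_ivt C m.+1 1 a theta a1.
    by rewrite rate1 // ltW.
  exists b; split=> //; first by exists m.+1.
  move=> k /andP[k0]; rewrite leq_eqVlt => /predU1P[->|km]; first by rewrite bt.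
  have b0 : 0 < b by apply: lt_le_trans b1.
  apply: (@le_trans _ _ (rate C k a)); last by apply: le_a; rewrite k0.
  by move: ba; rewrite le_eqVlt => /predU1P[->//|ba]; rewrite ltW // ltr_rate.
exists a; apply/is_alpha_starE => //; split=> //.
(* [theta] is the largest rate at [a], hence the one at [gamma]. *)
apply/eqP; rewrite eq_le -{2}ka rate_le_gamma // andbT le_a //.
by rewrite gamma_gt0 ?gamma_le // (lt_le_trans _ a1).
Qed.

(** If [a < b], the rate at index [gamma C a] grows strictly from [a] to [b], where it is at most
    the maximum; so the maximal rate is strictly increasing. *)
Lemma alpha_star_unique {R : realType} (C : nat) (theta a b : R) : (0 < C)%N ->
  is_alpha_star C theta a -> is_alpha_star C theta b -> a = b.
Proof.
move=> C0; wlog ab : a b / a < b.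
  by case: (ltgtP a b) => // ab wl Ha Hb; [exact: wl | symmetry; exact: wl].
move=> /(is_alpha_starE _ _ _ C0)[a1 ea] /(is_alpha_starE _ _ _ C0)[b1 eb].
have a0 : 0 < a by apply: lt_le_trans a1.
have := ltr_rate C (gamma C a) a b C0 (gamma_gt0 _ _ C0 a0) a0 ab.
by rewrite ea -eb ltNge rate_le_gamma // gamma_le.
Qed.

(** * The pricing function and its partial sums *)

Lemma pricing_function_small {R : realType} (C z : nat) (L a : R) :
  (z <= gamma C a)%N -> pricing_function C L a z = L.
Proof. by rewrite /pricing_function => ->. Qed.

(** This form avoids truncated subtraction and, [j] being arbitrary, also covers [phi (C + 1)]. *)
Lemma pricing_function_large {R : realType} (C j : nat) (L a : R) :
  pricing_function C L a (gamma C a + j).+1 =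
  (gamma C a)%:R * L * a / C%:R * (1 + a / C%:R) ^+ j.
Proof.
rewrite /pricing_function leqNgt ltnS leq_addr /=.
by rewrite -addnS addnC addnK subn1.
Qed.

Lemma pricing_function_gt0 {R : realType} (C z : nat) (L a : R) : (0 < C)%N ->
  0 < L -> 1 <= a -> 0 < pricing_function C L a z.
Proof.
move=> C0 L0 a1; have a0 : 0 < a by apply: lt_le_trans a1.
have c0 : 0 < C%:R :> R by rewrite ltr0n.
have [zg|] := leqP z (gamma C a); first by rewrite pricing_function_small.
case: z => // z; rewrite ltnS => /subnKC<-; rewrite pricing_function_large.
by rewrite mulr_gt0 ?exprn_gt0 ?addr_gt0 ?divr_gt0 ?mulr_gt0 ?ltr0n ?gamma_gt0.
Qed.

Lemma le_pricing_function {R : realType} (C : nat) (L a : R) : (0 < C)%N ->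
  0 < L -> 1 <= a -> {homo pricing_function C L a : y z / (y <= z)%N >-> y <= z}.
Proof.
move=> C0 L0 a1; have a0 : 0 < a by apply: lt_le_trans a1.
have c0 : 0 < C%:R :> R by rewrite ltr0n.
apply: homo_leq => [//|y x z|z]; first exact: le_trans.
have [zg|gz] := ltnP z (gamma C a).
  by rewrite !pricing_function_small // ltnW.
have [->|zg] := eqVneq z (gamma C a).
  (* At the end of the flat part, [L <= gamma L a / C] amounts to [C / a <= gamma]. *)
  have := pricing_function_large C 0 L a; rewrite addn0 => ->.
  rewrite pricing_function_small // expr0 mulr1 ler_pdivlMr //.
  rewrite [_ * L]mulrC -mulrA ler_pM2l //.
  have /andP[_] := gamma_itv C a C0 a0.
  by rewrite ler_pdivrMr.
case: z gz zg => [|z]; first by rewrite leqn0 => /eqP->; rewrite eqxx.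
rewrite leq_eqVlt eq_sym => /orP[->//|gz _].
rewrite -(subnKC (gz : (gamma C a <= z)%N)).
rewrite pricing_function_large -addnS pricing_function_large.
rewrite ler_wpM2l ?divr_ge0 ?mulr_ge0 ?(ltW L0) ?(ltW a0) //.
by rewrite exprS ler_peMl ?exprn_ge0 ?lerDl ?addr_ge0 ?divr_ge0 // ltW.
Qed.

(** [phi (C + 1)] is [L] times the rate at [gamma], so this is the defining equation of alpha. *)
Lemma pricing_function_last {R : realType} (C : nat) (L U a : R) : (0 < C)%N ->
  0 < L -> is_alpha_star C (U / L) a -> pricing_function C L a C.+1 = U.
Proof.
move=> C0 L0 /(is_alpha_starE _ _ _ C0)[a1 e].
have := pricing_function_large C (C - gamma C a) L a.
rewrite subnKC ?gamma_le // => ->.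
by rewrite -[RHS](divfK (lt0r_neq0 L0)) -e /rate; ring.
Qed.

(** At [w = gamma] both sides are [a gamma L]. From there prices grow by the factor [1 + a / C], so
    [a phi (w + 1) = C (phi (w + 2) - phi (w + 1))]. *)
Lemma sum_pricing_function {R : realType} (C w : nat) (L a : R) : (0 < C)%N ->
  (gamma C a <= w)%N ->
  a * (\sum_(z < w) pricing_function C L a z.+1) =
  C%:R * pricing_function C L a w.+1.
Proof.
move=> C0 /subnKC<-; have c0 : C%:R != 0 :> R by rewrite pnatr_eq0 -lt0n.
elim: (w - _)%N => [|j IH].
  rewrite pricing_function_large addn0 (eq_bigr (fun=> L)) => [|i _].
    by rewrite sumr_const card_ord -mulr_natl expr0; field.
  by rewrite pricing_function_small.
rewrite addnS big_ord_recr /= mulrDr IH pricing_function_large -addnS.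
rewrite pricing_function_large exprS.
by move: (_ ^+ j) => q; field.
Qed.

(** Serves the lower bound, where fewer than [gamma] units may be sold: then all prices are [L], and
    [a w <= C] follows from [w <= gamma - 1 < C / a]. *)
Lemma sum_pricing_function_le {R : realType} (C w : nat) (L a : R) : (0 < C)%N ->
  0 < L -> 1 <= a ->
  a * (\sum_(z < w) pricing_function C L a z.+1) <=
  C%:R * pricing_function C L a w.+1.
Proof.
move=> C0 L0 a1; have a0 : 0 < a by apply: lt_le_trans a1.
have [gw|wg] := leqP (gamma C a) w; first by rewrite sum_pricing_function.
rewrite pricing_function_small // (eq_bigr (fun=> L)) => [|i _].
  rewrite sumr_const card_ord -[L *+ w]mulr_natl mulrA ler_pM2r //.
  have /andP[lt_g _] := gamma_itv C a C0 a0.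
  rewrite mulrC -ler_pdivlMr // (le_trans _ (ltW lt_g)) //.
  by rewrite lerBrDr natr1 ler_nat.
by rewrite pricing_function_small // (leq_trans _ wg) // ltnS ltnW.
Qed.

(** * Runs of an arbitrary algorithm and the offline optimum *)

Lemma decisions_rcons {R : realType} (C : nat) (A : online_algorithm R)
    (I : seq R) (v : R) :
  decisions C A (rcons I v) = rcons (decisions C A I)
    ((A (decisions C A I) <= v) && (count id (decisions C A I) < C)%N).
Proof. by rewrite /decisions; elim: I [::] => //= u I IH past; rewrite IH. Qed.

Lemma size_decisions {R : realType} (C : nat) (A : online_algorithm R)
    (I : seq R) : size (decisions C A I) = size I.
Proof.
by elim/last_ind: I => // I v IH; rewrite decisions_rcons !size_rcons IH.
Qed.

Lemma ALG_rcons {R : realType} (C : nat) (A : online_algorithm R)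
    (I : seq R) (v : R) :
  ALG C A (rcons I v) = ALG C A I +
    v * ((A (decisions C A I) <= v) && (count id (decisions C A I) < C)%N)%:R.
Proof.
rewrite /ALG size_rcons big_ord_recr /= nth_rcons ltnn eqxx decisions_rcons.
rewrite nth_rcons size_decisions ltnn eqxx; congr (_ + _).
by apply: eq_bigr => i _; rewrite !nth_rcons size_decisions ltn_ord.
Qed.

Definition sold {R : realType} (C : nat) (A : online_algorithm R)
  (I : seq R) : nat := count id (decisions C A I).

Lemma sold_rcons {R : realType} (C : nat) (A : online_algorithm R)
    (I : seq R) (v : R) :
  sold C A (rcons I v) =
  (sold C A I + ((A (decisions C A I) <= v)%R && (sold C A I < C)))%N.
Proof. by rewrite /sold decisions_rcons -cats1 count_cat /= addn0. Qed.

Lemma sold_le {R : realType} (C : nat) (A : online_algorithm R) (I : seq R) :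
  (sold C A I <= C)%N.
Proof.
elim/last_ind: I => // I v IH; rewrite sold_rcons.
by case: leP => _ /=; rewrite ?addn0 //; case: ltnP; rewrite ?addn1 ?addn0.
Qed.

(** Weak duality with [p] as unit price: at most [C] values are chosen, each at most
    [p + max 0 (v - p)]. *)
Lemma OPT_le {R : realType} (C : nat) (p : R) (I : seq R) : 0 <= p ->
  OPT C I <= C%:R * p + \sum_(v <- I) Num.max 0 (v - p).
Proof.
move=> p0; rewrite /OPT.
have perm_I : perm_eq (sort >=%R I) I by rewrite perm_sort.
rewrite -(perm_big _ perm_I) /=; move: {I perm_I}(sort _ I) => s.
apply: (@le_trans _ _ (\sum_(v <- take C s) (p + Num.max 0 (v - p)))).
  by apply: ler_sum => v _; rewrite -lerBlDl le_max lexx orbT.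
rewrite big_split /= lerD //.
  rewrite big_const_seq count_predT iter_addr_0 -[p *+ _]mulr_natl ler_wpM2r //.
  by rewrite ler_nat size_take_min geq_minl.
rewrite -{2}(cat_take_drop C s) big_cat /= lerDl sumr_ge0 // => v _.
by rewrite le_max lexx.
Qed.

Lemma OPT_gt0 {R : realType} (C : nat) (I : seq R) : (0 < C)%N ->
  (0 < size I)%N -> {in I, forall v, 0 < v} -> 0 < OPT C I.
Proof.
move=> C0; rewrite /OPT -(size_sort >=%R I) => sI I0.
have {I0} : {in sort >=%R I, forall v, 0 < v}.
  by move=> v; rewrite mem_sort; exact: I0.
case: (sort _ I) sI => // u s _ s0; case: C C0 => // C _ /=.
rewrite big_cons ltr_wpDr ?s0 ?mem_head // big_seq sumr_ge0 // => v /mem_take vs.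
by rewrite ltW // s0 // inE vs orbT.
Qed.

Lemma OPT_cat_nseq {R : realType} (C : nat) (I : seq R) (v : R) :
  sorted <=%R (I ++ nseq C v) -> OPT C (I ++ nseq C v) = C%:R * v.
Proof.
move=> sI; rewrite /OPT.
have -> : sort >=%R (I ++ nseq C v) = rev (I ++ nseq C v).
  have /perm_sortP-> // : perm_eq (I ++ nseq C v) (rev (I ++ nseq C v)).
  - by rewrite perm_sym perm_rev.
  - rewrite sorted_sort ?rev_sorted //; exact: rev_trans le_trans.
  - by move=> x y; exact: le_total.
  - by move=> x y z xy yz; exact: le_trans yz xy.
  - by move=> x y; rewrite andbC => /le_anti.
rewrite rev_cat rev_nseq take_size_cat ?size_nseq //.
by rewrite big_nseq iter_addr_0 mulr_natl.
Qed.

Lemma ALG_ge0 {R : realType} (C : nat) (A : online_algorithm R) (I : seq R) :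
  {in I, forall v, 0 <= v} -> 0 <= ALG C A I.
Proof.
by move=> I0; apply: sumr_ge0 => i _; rewrite mulr_ge0 ?ler0n // I0 ?mem_nth.
Qed.

(** * Upper bound for dynamic pricing *)

Lemma ALG_dynamic_pricing_ge {R : realType} (C : nat) (phi : nat -> R)
    (a p : R) (I : seq R) : 1 <= a ->
  {homo phi : y z / (y <= z)%N >-> y <= z} ->
  {in I, forall v, v <= phi C.+1} ->
  phi (sold C (dynamic_pricing phi) I).+1 <= p ->
  a * (\sum_(z < sold C (dynamic_pricing phi) I) phi z.+1) +
    \sum_(v <- I) Num.max 0 (v - p) <= a * ALG C (dynamic_pricing phi) I.
Proof.
move=> a1 phi_homo; set A := dynamic_pricing phi.
have AE J : A (decisions C A J) = phi (sold C A J).+1 by [].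
(* [p] stays fixed in the induction; its hypothesis passes to prefixes because posted prices never
   fall. *)
elim/last_ind: I => [|I v IH] leU.
  by rewrite /sold /ALG /= big_nil !big_ord0 !mulr0 addr0.
have leU' : {in I, forall u, u <= phi C.+1}.
  by move=> u uI; apply: leU; rewrite mem_rcons inE uI orbT.
have vU : v <= phi C.+1 by apply: leU; rewrite mem_rcons inE eqxx.
rewrite sold_rcons ALG_rcons -cats1 big_cat /= big_seq1 mulrDr.
rewrite -/(sold C A I) AE.
have kC := sold_le C A I.
case: (boolP (_ && _)) => [/andP[le_v _]|unsold].
  rewrite addn1 big_ord_recr /= mulr1 mulrDr => le_p.
  have le_p' : phi (sold C A I).+1 <= p by apply: le_trans le_p; exact: phi_homo.
  (* Let [q <= p] be the price paid. If [p <= v], then [a q + (v - p) <= a p + a (v - p)]; otherwise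
     [q <= v] suffices. *)
  suff : a * phi (sold C A I).+1 + Num.max 0 (v - p) <= a * v.
    by move=> le_v'; rewrite addrACA lerD ?IH.
  have [vp|pv] := leP 0 (v - p).
    have : a * phi (sold C A I).+1 <= a * p by rewrite ler_wpM2l ?(le_trans ler01).
    have : 0 <= (a - 1) * (v - p) by rewrite mulr_ge0 // subr_ge0.
    by lra.
  by rewrite addr0 ler_wpM2l // (le_trans ler01).
rewrite addn0 mulr0 mulr0 addr0 => le_p.
(* A rejected value is below the current price, or all units are gone and it is at most
   [phi (C + 1)]; both are at most [p]. *)
suff /max_idPl-> : v - p <= 0 by rewrite addr0 IH.
rewrite subr_le0 (le_trans _ le_p) //.
move: unsold; rewrite negb_and -ltNge -leqNgt => /orP[/ltW//|Ck].
by rewrite (le_trans vU) // phi_homo.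
Qed.

(** Below [g] sales the price is still [L], so nobody is turned away. *)
Lemma ALG_dynamic_pricing_sum {R : realType} (C g : nat) (phi : nat -> R)
    (L : R) (I : seq R) : (g <= C)%N ->
  (forall z, (z <= g)%N -> phi z = L) -> {in I, forall v, L <= v} ->
  (sold C (dynamic_pricing phi) I < g)%N ->
  ALG C (dynamic_pricing phi) I = \sum_(v <- I) v.
Proof.
move=> gC phiL; set A := dynamic_pricing phi.
have AE J : A (decisions C A J) = phi (sold C A J).+1 by [].
elim/last_ind: I => [|I v IH] geL; first by rewrite /ALG big_nil big_ord0.
have geL' : {in I, forall u, L <= u}.
  by move=> u uI; apply: geL; rewrite mem_rcons inE uI orbT.
have Lv : L <= v by apply: geL; rewrite mem_rcons inE eqxx.
rewrite sold_rcons => lt_g.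
have kg : (sold C A I < g)%N by apply: leq_ltn_trans lt_g; exact: leq_addr.
rewrite ALG_rcons IH // -cats1 big_cat /= big_seq1 -/(sold C A I).
rewrite AE phiL // Lv (leq_trans kg gC).
by rewrite mulr1.
Qed.

Lemma dynamic_pricing_competitive {R : realType} (C : nat) (L U a : R) :
  (0 < C)%N -> 0 < L -> is_alpha_star C (U / L) a ->
  competitive C L U a (dynamic_pricing (pricing_function C L a)).
Proof.
move=> C0 L0 aS; have [a1 _] := aS; have a0 : 0 < a by apply: lt_le_trans a1.
have phi_homo := le_pricing_function C L a C0 L0 a1.
have phiU := pricing_function_last C L U a C0 L0 aS.
apply/ereal_supP => _ [I [I0 ILU] <-].
set A := dynamic_pricing _.
have geL : {in I, forall v, L <= v} by move=> v /ILU/andP[].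
have OPT0 : 0 < OPT C I.
  by apply: OPT_gt0 => // v /geL; exact: lt_le_trans.
suff le_ALG : OPT C I <= a * ALG C A I.
  have ALG0 : 0 < ALG C A I by rewrite -(pmulr_rgt0 _ a0) (lt_le_trans OPT0).
  by rewrite inver gt_eqF // lee_pdivrMr // lee_fin.
have [gk|kg] := leqP (gamma C a) (sold C A I).
  apply: (le_trans (OPT_le C (pricing_function C L a (sold C A I).+1) I _)).
    by rewrite ltW ?pricing_function_gt0.
  rewrite -sum_pricing_function //; apply: ALG_dynamic_pricing_ge => //.
  by move=> v /ILU/andP[_]; rewrite phiU.
rewrite (ALG_dynamic_pricing_sum C (gamma C a) _ L) ?gamma_le //; last first.
  by move=> z; exact: pricing_function_small.
(* Taking [p = 0] bounds the optimum by the sum of all values, which the algorithm collects here. *)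
have := OPT_le C 0 I (lexx 0); rewrite mulr0 add0r => /le_trans; apply.
have -> : \sum_(v <- I) Num.max 0 (v - 0) = \sum_(v <- I) v.
  rewrite big_seq [RHS]big_seq; apply: eq_bigr => v /geL Lv.
  by rewrite subr0; apply/max_idPr; rewrite (le_trans (ltW L0)).
rewrite ler_peMl // big_seq sumr_ge0 // => v /geL; apply: le_trans; exact: ltW.
Qed.

(** * Lower bound for every deterministic algorithm *)

(* [C] buyers for each of the values [L], [phi (gamma + 1)], ..., [phi C],
   [phi (C + 1) = U], in this order. *)
Definition adversary {R : realType} (C : nat) (L a : R) (m : nat) : seq R :=
  mkseq (fun n => pricing_function C L a (gamma C a + n %/ C)) m.

Lemma adversaryS {R : realType} (C m : nat) (L a : R) :
  adversary C L a m.+1 = rcons (adversary C L a m)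
    (pricing_function C L a (gamma C a + m %/ C)).
Proof. exact: mkseqS. Qed.

Lemma OPT_adversary {R : realType} (C i : nat) (L a : R) : (0 < C)%N ->
  0 < L -> 1 <= a ->
  OPT C (adversary C L a (i.+1 * C)) =
  C%:R * pricing_function C L a (gamma C a + i).
Proof.
move=> C0 L0 a1; have phi_homo := le_pricing_function C L a C0 L0 a1.
have sI : sorted <=%R (adversary C L a (i.+1 * C)).
  apply: homo_sorted (iota_sorted 0 _) => m n mn.
  by rewrite phi_homo // leq_add2l leq_div2r.
have eI : adversary C L a (i.+1 * C) = adversary C L a (i * C) ++
    nseq C (pricing_function C L a (gamma C a + i)).
  rewrite /adversary mulSnr /mkseq iotaD map_cat; congr (_ ++ _).
  apply: (@eq_from_nth _ 0); rewrite size_map size_iota ?size_nseq // => n nC.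
  rewrite (nth_map 0%N) ?size_iota // nth_iota // nth_nseq nC.
  by rewrite add0n divnMDl // divn_small // addn0.
by rewrite eI OPT_cat_nseq // -eI.
Qed.

Lemma sold_adversary_homo {R : realType} (C : nat) (L a : R)
    (A : online_algorithm R) :
  {homo (fun m => sold C A (adversary C L a m)) : m n / (m <= n)%N}.
Proof.
apply: homo_leq => [//|y x z|m]; first exact: leq_trans.
by rewrite adversaryS sold_rcons leq_addr.
Qed.

(** Phases are numbered from 0. By hypothesis at least [gamma + j - 1] units are sold before phase
    [j], so a unit sold in it is the [z]-th with [z >= gamma + j], and its value [phi (gamma + j)]
    is at most [phi z]. *)
Lemma ALG_adversary_le {R : realType} (C m : nat) (L a : R)
    (A : online_algorithm R) : (0 < C)%N -> 0 < L -> 1 <= a ->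
  (forall j, (0 < j)%N -> (j * C < m)%N ->
     (gamma C a + j <= (sold C A (adversary C L a (j * C))).+1)%N) ->
  ALG C A (adversary C L a m) <=
  \sum_(z < sold C A (adversary C L a m)) pricing_function C L a z.+1.
Proof.
move=> C0 L0 a1; have phi_homo := le_pricing_function C L a C0 L0 a1.
elim: m => [|m IH] Hm; first by rewrite /sold /ALG !big_ord0.
have {IH} := IH (fun j j0 jm => Hm j j0 (ltnW jm)).
rewrite adversaryS ALG_rcons sold_rcons -/(sold C A _).
case: (_ && _); rewrite ?addn0 ?mulr0 ?addr0 // addn1 mulr1 big_ord_recr /=.
move=> le_ALG; rewrite lerD //.
have [->|j0] := posnP (m %/ C).
  rewrite addn0 pricing_function_small //.
  (* In phase 0 the value [L] is read as [phi 0], so that monotonicity of the prices applies. *)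
  by rewrite -[leLHS](@pricing_function_small _ C 0 L a) // phi_homo.
apply: phi_homo; apply: (leq_trans (Hm _ j0 _)).
  by rewrite ltnS leq_trunc_div.
by rewrite ltnS sold_adversary_homo // leq_trunc_div.
Qed.

Lemma competitive_ratio_ge {R : realType} (C : nat) (L U a : R)
    (A : online_algorithm R) : (0 < C)%N -> 0 < L ->
  is_alpha_star C (U / L) a -> (a%:E <= competitive_ratio C L U A)%E.
Proof.
move=> C0 L0 aS; have [a1 _] := aS; have a0 : 0 < a by apply: lt_le_trans a1.
have phi_homo := le_pricing_function C L a C0 L0 a1.
have phiU := pricing_function_last C L U a C0 L0 aS.
have gC := gamma_le C a C0 a1.
pose P i := (sold C A (adversary C L a (i.+1 * C)) < gamma C a + i)%N.
(* For this phase the threshold [gamma + i] is [C + 1], more than can be sold. *)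
have P_last : P (C.+1 - gamma C a)%N.
  by rewrite /P subnKC ?ltnS ?sold_le // ltnW.
have exP : exists i, P i by exists (C.+1 - gamma C a)%N.
case: (ex_minnP exP) => i Pi min_i.
have iC : (gamma C a + i <= C.+1)%N by rewrite -leq_subRL ?min_i // ltnW.
set I := adversary C L a (i.+1 * C).
have ILU : {in I, forall v, L <= v <= U}.
  move=> _ /mapP[n + ->]; rewrite mem_iota add0n -ltn_divLR // ltnS => ni.
  rewrite -{1}(@pricing_function_small _ C 0 L a) // -phiU !phi_homo //.
  by rewrite (leq_trans _ iC) // leq_add2l.
have OPTE : OPT C I = C%:R * pricing_function C L a (gamma C a + i).
  exact: OPT_adversary.
have OPT0 : 0 < OPT C I by rewrite OPTE mulr_gt0 ?ltr0n ?pricing_function_gt0.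
have le_OPT : a * ALG C A I <= OPT C I.
  have : ALG C A I <= \sum_(z < sold C A I) pricing_function C L a z.+1.
    apply: ALG_adversary_le => // -[//|j] _; rewrite ltn_pmul2r // ltnS => ji.
    rewrite addnS ltnS leqNgt; apply/negP => /min_i.
    by rewrite leqNgt ji.
  rewrite -(ler_pM2l a0) => /le_trans; apply.
  apply: (le_trans (sum_pricing_function_le _ _ _ _ C0 L0 a1)).
  (* [P i] says [sold + 1 <= gamma + i]. *)
  by rewrite OPTE ler_wpM2l // phi_homo.
apply: le_ereal_sup_tmp; exists ((OPT C I)%:E / (ALG C A I)%:E)%E.
  by exists I => //; split=> //; rewrite size_mkseq muln_gt0.
have : 0 <= ALG C A I.
  by apply: ALG_ge0 => v /ILU/andP[Lv _]; rewrite (le_trans (ltW L0)).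
(* If the welfare is 0, the ratio is [+oo]. *)
rewrite le_eqVlt => /predU1P[<-|ALG0].
  by rewrite inve0 gt0_muley ?leey // lte_fin.
by rewrite inver gt_eqF // lee_pdivlMr // lee_fin.
Qed.

Theorem lemma1 (R : realType) (C : nat) (L U : R)
    (hC : (1 <= C)%N) (hL : 0 < L) (hLU : L <= U) :
  (exists! alpha : R, is_alpha_star C (U / L) alpha) /\
  forall alpha : R, is_alpha_star C (U / L) alpha ->
    [/\ forall z : nat, (1 <= z <= C)%N ->
          L <= pricing_function C L alpha z <= U,
        competitive C L U alpha (dynamic_pricing (pricing_function C L alpha)),
        exists A : online_algorithm R, competitive_ratio C L U A = alpha%:E
      & forall A : online_algorithm R,
          (alpha%:E <= competitive_ratio C L U A)%E].
Proof.
split.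
  have [|a aS] := alpha_star_exists C (U / L) hC.
    by rewrite ler_pdivlMr // mul1r.
  by exists a; split=> // b; exact: alpha_star_unique.
move=> a aS; have [a1 _] := aS.
have phi_homo := le_pricing_function C L a hC hL a1.
have comp := dynamic_pricing_competitive C L U a hC hL aS.
have lower A := competitive_ratio_ge C L U a A hC hL aS.
split=> //.
  move=> z /andP[_ zC].
  rewrite -{1}(@pricing_function_small _ C 0 L a) // phi_homo //=.
  by rewrite -(pricing_function_last C L U a hC hL aS) phi_homo // ltnW.
exists (dynamic_pricing (pricing_function C L a)).
by apply/le_anti/andP; split; [exact: comp | exact: lower].
Qed.
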